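(* Let $G$ be an abelian group and $S\subset\mathcal P_G$. If $\mathbb F$ is a real closed field, then $$\mathrm H^2_S(\mathbb F^\times)\simeq\frac{\mathrm{Hom}(\mathcal I_S,\{\pm1\})}{\mathrm B^2_S(\{\pm1\})}\oplus\mathrm{Hom}(\mathcal K_S,\mathbb F^\times),$$ where $\mathrm{Hom}(\mathcal I_S,\{\pm1\})/\mathrm B^2_S(\{\pm1\})$ is an elementary abelian $2$-group. If $G$ is finite, then the rank of this group (i.e., its dimension as a vector space over the field of $2$ elements) is at most $\operatorname{rank}G_{[2]}+N'$.
   Context: $G$ is written multiplicatively with identity $e$; $G_{[2]}=\{g\in G\mid g^2=e\}$, and its rank is its dimension over the field of $2$ elements. $\mathcal P_G$ is the set of unordered pairs $\{g,h\}$ of elements of $G$ (with $g=h$ allowed). $\mathcal F_G$ is the free abelian group (written multiplicatively) on $\mathcal P_G$, and $\mathcal R_G\subset\mathcal F_G$ is the set of all elements $\{g,h\}\{gh,k\}\{h,k\}^{-1}\{g,hk\}^{-1}$ with $g,h,k\in G$. For $S\subset\mathcal P_G$, $\mathcal F_S\subset\mathcal F_G$ is the free abelian group on $S$, $\mathcal R_S:=\mathcal R_G\cap\mathcal F_S$, $\mathcal Z_S:=\mathcal F_S/\langle\mathcal R_S\rangle$, $\mathcal Z_G:=\mathcal F_G/\langle\mathcal R_G\rangle$. Let $f\colon\mathcal Z_S\to\mathcal Z_G$ be induced by the inclusion $\mathcal F_S\hookrightarrow\mathcal F_G$; $\mathcal K_S:=\ker f=(\langle\mathcal R_G\rangle\cap\mathcal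 F_S)/\langle\mathcal R_S\rangle$ and $\mathcal I_S:=\operatorname{im}f\simeq\mathcal F_S/(\langle\mathcal R_G\rangle\cap\mathcal F_S)$. $N'$ is the free rank of $\mathcal F_S/(\langle\mathcal R_G\rangle\cap\mathcal F_S)$. For an abelian group $A$ (here $A=\mathbb F^\times$ or $A=\{\pm1\}$), $\mathrm B^2_S(A)$ is the group of restrictions to $S$ of the functions $d\alpha(g,h)=\alpha(g)\alpha(h)\alpha(gh)^{-1}$, for arbitrary maps $\alpha\colon G\to A$, viewed as a subgroup of $\mathrm{Fun}(S,A)=\mathrm{Hom}(\mathcal F_S,A)$; it lies in $\mathrm{Hom}(\mathcal Z_S,A)$, and in fact in $\mathrm{Hom}(\mathcal I_S,A)$, regarded as a subgroup of $\mathrm{Hom}(\mathcal Z_S,A)$ via composition with $f$. $\mathrm H^2_S(A):=\mathrm{Hom}(\mathcal Z_S,A)/\mathrm B^2_S(A)$. *)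

(* Defs.v *)
From HB Require Import structures.
From mathcomp Require Import all_boot all_order all_algebra finmap.
From mathcomp Require Import ring_quotient.
From mathcomp Require Import boolp classical_sets functions.
From mathcomp.multinomials Require Import freeg.

Set Implicit Arguments.
Unset Strict Implicit.
Unset Printing Implicit Defensive.

Import GRing.Theory Num.Theory.
Local Open Scope ring_scope.

(* Abelian groups are [zmodType]s, hence written additively throughout: in G,
   in the free group on pairs, and in the multiplicative group of a field.
   Subsets and subgroups are classical: membership is decided by [asbool]. *)

Definition isomorphic (A B : zmodType) : Prop :=
  exists phi : {additive A -> B}, bijective phi.

Section Subgroups.
Variable V : zmodType.

Record subgrp (H : zmodClosed V) : Type :=
  Subgrp { subgrp_val : V; _ : subgrp_val \in H }.
HB.instance Definition _ (H : zmodClosed V) := [isSub of subgrp H for @subgrp_val H].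
HB.instance Definition _ (H : zmodClosed V) := [Choice of subgrp H by <:].
HB.instance Definition _ (H : zmodClosed V) :=
  [SubChoice_isSubZmodule of subgrp H by <:].

Definition generated (X : set V) : {pred V} := fun x =>
  `[< forall H : zmodClosed V, (forall y, X y -> y \in H) -> x \in H >].

Lemma generated_closed X : zmod_closed (generated X).
Proof.
split=> [|x y /asboolP hx /asboolP hy]; apply/asboolP => H hH.
  exact: rpred0.
by rewrite rpredB ?hx ?hy.
Qed.
HB.instance Definition _ X := GRing.isZmodClosed.Build V (generated X)
  (generated_closed X).

Lemma mem_generated (X : set V) x : X x -> x \in generated X.
Proof. by move=> Xx; apply/asboolP => H; apply. Qed.

Lemma generated_min (X : set V) (H : zmodClosed V) :
  (forall y, X y -> y \in H) -> {subset generated X <= H}.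
Proof. by move=> XH x /asboolP; apply. Qed.

End Subgroups.

Section KernelImage.
Variables (A B : zmodType) (f : {additive A -> B}).

Definition ker_grp : {pred A} := fun x => f x == 0.
Lemma ker_grp_closed : zmod_closed ker_grp.
Proof.
split=> [|x y]; rewrite !unfold_in ?raddf0 // => /eqP hx /eqP hy.
by rewrite raddfB hx hy subrr.
Qed.
HB.instance Definition _ := GRing.isZmodClosed.Build A ker_grp ker_grp_closed.

Definition im_grp : {pred B} := fun y => `[< exists x, f x = y >].
Lemma im_grp_closed : zmod_closed im_grp.
Proof.
split=> [|_ _ /asboolP[x <-] /asboolP[y <-]]; apply/asboolP.
  by exists 0; rewrite raddf0.
by exists (x - y); rewrite raddfB.
Qed.
HB.instance Definition _ := GRing.isZmodClosed.Build B im_grp im_grp_closed.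

Lemma mem_image x : f x \in im_grp. Proof. by apply/asboolP; exists x. Qed.

Definition to_im_grp (x : A) : subgrp im_grp := Subgrp (mem_image x).
Lemma to_im_grp_additive : zmod_morphism to_im_grp.
Proof. by move=> x y; apply: val_inj; rewrite /= !raddfB. Qed.
HB.instance Definition _ :=
  GRing.isZmodMorphism.Build A (subgrp im_grp) to_im_grp to_im_grp_additive.

End KernelImage.

Section Preimage.
Variables (A B : zmodType) (f : {additive A -> B}) (H : zmodClosed B).

Definition preimage_grp : {pred A} := fun x => f x \in H.
Lemma preimage_grp_closed : zmod_closed preimage_grp.
Proof.
split=> [|x y]; rewrite -!topredE /= /preimage_grp ?raddf0 ?rpred0 // => hx hy.
by rewrite raddfB rpredB.
Qed.
HB.instance Definition _ :=
  GRing.isZmodClosed.Build A preimage_grp preimage_grp_closed.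

End Preimage.

Section QuotientMap.
Variables (A B : zmodType) (I : zmodClosed A) (J : zmodClosed B).
Variables (h : {additive A -> B}) (hIJ : forall x, x \in I -> h x \in J).

(* The proof argument is not computed with; it lets the additive structure of
   the map be inferred. *)
Definition quot_map of (forall x, x \in I -> h x \in J) :=
  fun x : Quotient.quot I => \pi_(Quotient.quot J)%qT (h (repr x)).

Lemma quot_map_pi x :
  quot_map hIJ (\pi_(Quotient.quot I)%qT x) = \pi_(Quotient.quot J)%qT (h x).
Proof.
apply/eqP; rewrite -Quotient.idealrBE -raddfB hIJ //.
by rewrite Quotient.idealrBE reprK.
Qed.

Lemma quot_map_additive : zmod_morphism (quot_map hIJ).
Proof.
move=> x y; rewrite -[x]reprK -[y]reprK -[X in quot_map _ X]raddfB.
by rewrite !quot_map_pi !raddfB.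
Qed.
HB.instance Definition _ := GRing.isZmodMorphism.Build
  (Quotient.quot I) (Quotient.quot J) (quot_map hIJ) quot_map_additive.

End QuotientMap.

Section HomGroup.
Variables A B : zmodType.

Definition is_hom : {pred A -> B} := fun f => `[< zmod_morphism f >].
Lemma is_hom_closed : zmod_closed is_hom.
Proof.
split=> [|f g /asboolP hf /asboolP hg]; apply/asboolP => x y.
  by rewrite subrr.
by rewrite !fctE hf hg !opprD addrACA.
Qed.
HB.instance Definition _ := GRing.isZmodClosed.Build (A -> B) is_hom is_hom_closed.

Definition HomZ : zmodType := subgrp is_hom.

Lemma HomB (phi : HomZ) : zmod_morphism (val phi).
Proof. exact/asboolP/(valP phi). Qed.

End HomGroup.

Section HomComp.
Variables (A B C : zmodType) (f : {additive A -> B}).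

Lemma comp_is_hom (phi : HomZ B C) : val phi \o f \in @is_hom A C.
Proof. by apply/asboolP => x y /=; rewrite raddfB HomB. Qed.

Definition Hom_comp (phi : HomZ B C) : HomZ A C := Subgrp (comp_is_hom phi).

Lemma Hom_comp_additive : zmod_morphism Hom_comp.
Proof. by move=> phi psi; apply: val_inj. Qed.
HB.instance Definition _ := GRing.isZmodMorphism.Build
  (HomZ B C) (HomZ A C) Hom_comp Hom_comp_additive.

End HomComp.

Section FieldUnits.
Variable F : fieldType.

(* F^x, with its group law written additively: [x + y] in [units] is the product
   of the underlying field elements. *)
Record units : Type := Units { units_val : F; _ : units_val != 0 }.
HB.instance Definition _ := [isSub of units for units_val].
HB.instance Definition _ := [Choice of units by <:].

Lemma units_neq0 (x : units) : val x != 0. Proof. by case: x. Qed.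

Definition units_mul (x y : units) : units :=
  Units (mulf_neq0 (units_neq0 x) (units_neq0 y)).
Definition units_one : units := Units (oner_neq0 F).
Definition units_inv (x : units) : units := Units (invr_neq0 (units_neq0 x)).

Lemma units_mulA : associative units_mul.
Proof. by move=> x y z; apply: val_inj; rewrite /= mulrA. Qed.
Lemma units_mulC : commutative units_mul.
Proof. by move=> x y; apply: val_inj; rewrite /= mulrC. Qed.
Lemma units_mul1 : left_id units_one units_mul.
Proof. by move=> x; apply: val_inj; rewrite /= mul1r. Qed.
Lemma units_mulV : left_inverse units_one units_inv units_mul.
Proof. by move=> x; apply: val_inj; rewrite /= mulVf ?units_neq0. Qed.

HB.instance Definition _ :=
  GRing.isZmodule.Build units units_mulA units_mulC units_mul1 units_mulV.

(* {1, -1}, as a subgroup of F^x. *)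
Definition is_sign : {pred units} := fun x => (val x == 1) || (val x == -1).
Lemma is_sign_closed : zmod_closed is_sign.
Proof.
split=> [|x y]; rewrite -!topredE /= /is_sign /= ?eqxx // => hx hy.
case/orP: hx => /eqP ->; case/orP: hy => /eqP ->;
by rewrite ?invrN ?invr1 ?mulrN ?mulNr ?mulr1 ?opprK ?eqxx ?orbT.
Qed.
HB.instance Definition _ := GRing.isZmodClosed.Build units is_sign is_sign_closed.

Definition signs : zmodType := subgrp is_sign.

End FieldUnits.

Section Ranks.
Variable V : zmodType.

Definition elementary_2 : Prop := forall x : V, x + x = 0.

(* A coefficient c i in 'F_2 acts through its representative 0 or 1, which is
   the scalar multiplication of the 'F_2-vector space V once V is elementary. *)
Definition has_dim_F2 (n : nat) : Prop :=
  elementary_2 /\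
  exists b : 'I_n -> V, forall x : V,
    exists! c : {ffun 'I_n -> 'F_2}, x = \sum_(i < n) b i *+ c i.

(* V = Z^n + torsion; n is then uniquely determined by V. *)
Definition has_free_rank (n : nat) : Prop :=
  exists T : zmodType, (forall t : T, exists2 k : nat, (0 < k)%N & t *+ k = 0)
    /\ isomorphic V ('rV[int]_n * T)%type.

Definition is_2torsion : {pred V} := fun x => x + x == 0.
Lemma is_2torsion_closed : zmod_closed is_2torsion.
Proof.
split=> [|x y]; rewrite -!topredE /= /is_2torsion ?addr0 // => /eqP hx /eqP hy.
by rewrite addrACA -opprD hx hy subrr.
Qed.
HB.instance Definition _ := GRing.isZmodClosed.Build V is_2torsion is_2torsion_closed.

End Ranks.

Section Cohomology.
Variable G : zmodType.

(* {g, h} is the finite set with these elements, a singleton if g = h. *)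
Definition is_pair (p : {fset G}) : bool := (0 < #|` p| <= 2)%N.
Definition pairs : choiceType := {p : {fset G} | is_pair p}.

Lemma is_pair_fset2 (g h : G) : is_pair [fset g; h]%fset.
Proof. by rewrite /is_pair cardfs2; case: (g != h). Qed.
Definition pair_of (g h : G) : pairs := exist _ [fset g; h]%fset (is_pair_fset2 g h).

Definition FG : zmodType := {freeg pairs}.
Definition gen_of (g h : G) : FG := << pair_of g h >>.
Definition RG : set FG := [set x | exists g h k : G,
  x = gen_of g h + gen_of (g + h) k - gen_of h k - gen_of g (h + k)].
Definition ZG : zmodType := Quotient.quot (generated RG).

Variable S : set pairs.

(* F_S, as the subgroup of elements of F_G whose support lies in S. *)
Definition supported : {pred FG} := fun x => `[< forall p, p \in dom x -> S p >].
Lemma supported_closed : zmod_closed supported.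
Proof.
split=> [|x y /asboolP hx /asboolP hy]; apply/asboolP => p.
  by rewrite dom0.
by move/domB; rewrite mem_cat => /orP[/hx|/hy].
Qed.
HB.instance Definition _ := GRing.isZmodClosed.Build FG supported supported_closed.

Definition FS : zmodType := subgrp supported.
Definition RS : set FS := [set x | RG (val x)].
Definition ZS : zmodType := Quotient.quot (generated RS).

Lemma RS_sub_RG (x : FS) : x \in generated RS -> (val x : FG) \in generated RG.
Proof.
move: x; apply: (@generated_min _ _ (preimage_grp (val : {additive FS -> FG}) (generated RG))).
by move=> y Ry; apply: mem_generated.
Qed.

(* The map f : Z_S -> Z_G. *)
Definition incl_map : {additive ZS -> ZG} := quot_map RS_sub_RG.
Definition KS : zmodType := subgrp (ker_grp incl_map).
Definition IS : zmodType := subgrp (im_grp incl_map).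

(* F_S / (<R_G> \cap F_S) *)
Definition FS_mod_RG : zmodType :=
  Quotient.quot (preimage_grp (val : {additive FS -> FG}) (generated RG)).

Lemma supported_gen (s : set_type S) : (<< val s >> : FG) \in supported.
Proof.
apply/asboolP => p; rewrite domU1 mem_seq1 => /eqP ->.
exact/set_mem/(valP s).
Qed.
Definition class_of (s : set_type S) : ZS :=
  \pi_(Quotient.quot (generated RS))%qT (Subgrp (supported_gen s)).

Section Coefficients.
Variable A : zmodType.

(* The group B^2_S(A), inside Fun(S, A). *)
Definition is_coboundary : {pred set_type S -> A} := fun chi =>
  `[< exists alpha : G -> A, forall (s : set_type S) (g h : G),
        val s = pair_of g h -> chi s = alpha g + alpha h - alpha (g + h) >].
Lemma is_coboundary_closed : zmod_closed is_coboundary.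
Proof.
split=> [|x y /asboolP[a ha] /asboolP[b hb]]; apply/asboolP.
  by exists (fun=> 0) => s g h _; rewrite /= subr0 addr0.
exists (fun g => a g - b g) => s g h e.
rewrite !fctE (ha _ _ _ e) (hb _ _ _ e) !opprD !opprK [LHS]addrACA.
by congr (_ + _); rewrite addrACA.
Qed.
HB.instance Definition _ := GRing.isZmodClosed.Build (set_type S -> A)
  is_coboundary is_coboundary_closed.

Definition restr (phi : HomZ ZS A) : set_type S -> A :=
  fun s => val phi (class_of s).
Lemma restr_additive : zmod_morphism restr.
Proof. by []. Qed.
HB.instance Definition _ := GRing.isZmodMorphism.Build
  (HomZ ZS A) (set_type S -> A) restr restr_additive.

(* B^2_S(A) seen inside Hom(Z_S, A) and, through composition with f, inside
   Hom(I_S, A); [coboundary_Hom_IS] shows that no coboundary is lost. *)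
Definition B2_ZS : zmodClosed (HomZ ZS A) := preimage_grp restr is_coboundary.
Definition B2_IS : zmodClosed (HomZ IS A) :=
  preimage_grp (Hom_comp (to_im_grp incl_map)) B2_ZS.

Definition H2S : zmodType := Quotient.quot B2_ZS.
Definition HomIS_mod_B2 : zmodType := Quotient.quot B2_IS.

Lemma FS_hom_eq0 (h : {additive FS -> A}) :
  (forall s, h (Subgrp (supported_gen s)) = 0) -> forall x, h x = 0.
Proof.
move=> h0 x; pose y : {freeg pairs} := val x.
have -> : x = \sum_(s <- pmap insub (dom y))
     (Subgrp (supported_gen s) : FS) *~ coeff (val (s : set_type S)) y.
  apply: val_inj; rewrite raddf_sum.
  under eq_bigr do rewrite raddfMz.
  rewrite -(big_map val xpredT (fun p => (<< p >> : {freeg pairs}) *~ coeff p y)).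
  rewrite pmap_filter; last exact: insubK.
  have /all_filterP -> : all (fun p => insub p : option (set_type S)) (dom y).
    apply/allP => p py; rewrite isSome_insub.
    by have /asboolP/(_ p py)/mem_set := valP x.
  rewrite -[LHS](freeg_sumE y).
  by apply: eq_bigr => p _; rewrite freegU_mulz intz.
by rewrite raddf_sum big1 // => s _; rewrite raddfMz h0 mul0rz.
Qed.

Lemma pair_of_inj g h g' h' : pair_of g h = pair_of g' h' ->
  (g = g' /\ h = h') \/ (g = h' /\ h = g').
Proof.
move=> /(congr1 val)/fsetP /= e.
have := (e g, e h, e g', e h'); rewrite !inE !eqxx !orbT /=.
move=> [[[/esym/orP e1 /esym/orP e2] /orP e3] /orP e4].
by case: e1 => /eqP e1; case: e2 => /eqP e2; case: e3 => /eqP e3;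
   case: e4 => /eqP e4; subst; auto.
Qed.

Lemma coboundary_Hom_IS (chi : set_type S -> A) : chi \in is_coboundary ->
  exists! phi : HomZ IS A, restr (Hom_comp (to_im_grp incl_map) phi) = chi.
Proof.
move=> /asboolP[a chiE].
have uniq_phi (phi psi : HomZ IS A) :
    restr (Hom_comp (to_im_grp incl_map) phi) =
    restr (Hom_comp (to_im_grp incl_map) psi) -> phi = psi.
  move=> e; apply: val_inj; apply/funext => u.
  have /asboolP[v uE] := valP u.
  have -> : u = to_im_grp incl_map v by apply: val_inj; rewrite -uE.
  pose q (x : FS) : ZS := \pi_(Quotient.quot (generated RS))%qT x.
  pose delta (x : FS) := val phi (to_im_grp incl_map (q x)) -
                         val psi (to_im_grp incl_map (q x)).
  have deltaB : zmod_morphism delta.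
    by move=> x y; rewrite /delta /q !raddfB !HomB !opprD addrACA.
  pose deltaA := HB.pack_for {additive FS -> A} delta
    (GRing.isZmodMorphism.Build FS A delta deltaB).
  have d0 : forall s, deltaA (Subgrp (supported_gen s)) = 0.
    by move=> s; apply/eqP; rewrite subr_eq0; apply/eqP/(congr1 (@^~ s) e).
  apply/eqP; rewrite -subr_eq0 -[v]reprK; apply/eqP.
  exact: (FS_hom_eq0 (h := deltaA) d0 (repr v)).
have pairP (p : pairs) : exists gh : G * G, p = pair_of gh.1 gh.2.
  case: p => p p12; have := p12; rewrite {1}/is_pair.
  case En: #|` p| => [|[|[|n]]] // _.
    have /cardfs1P[g pE] : #|` p| == 1%N by rewrite En.
    by exists (g, g); apply: val_inj; rewrite /= pE fsetUid.
  have /fset0Pn[g gp] : p != fset0%fset by rewrite -cardfs_gt0 En.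
  have /cardfs1P[h pE] : #|` p `\ g|%fset == 1%N.
    by move/eqP: En; rewrite (cardfsD1 g) gp add1n eqSS.
  by exists (g, h); apply: val_inj; rewrite /= -pE fsetD1K.
pose d (p : pairs) : ssrint.zmodule A := let gh := sval (cid (pairP p)) in
  a gh.1 + a gh.2 - a (gh.1 + gh.2).
have dE g h : d (pair_of g h) = a g + a h - a (g + h).
  rewrite /d; case: cid => -[g' h'] /= /pair_of_inj[[<- <-]|[<- <-]] //.
  by rewrite [a h + _]addrC [h + _]addrC.
pose D : {additive FG -> A} := HB.pack_for {additive FG -> A} (fglift d : FG -> A)
  (GRing.isZmodMorphism.Build FG A (fglift d : FG -> A) (lift_is_additive d)).
have DE g h : D (gen_of g h) = a g + a h - a (g + h).
  by have := liftU d 1 (pair_of g h); rewrite scale1r dE.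
have D0 : {subset generated RG <= ker_grp D}.
  apply: generated_min => _ [g [h [k ->]]]; apply/eqP.
  rewrite !raddfB raddfD !DE addrA -[LHS]addrA -opprD; apply/eqP.
  rewrite subr_eq0 (addrC (a g) (a (h + k))) -!addrA !addKr.
  by rewrite (addrCA (a k) (a g)) (addrCA (a h) (a g)).
pose E (z : ZG) : A := D (repr z).
have Epi x : E (\pi_(Quotient.quot (generated RG))%qT x) = D x.
  apply/eqP; rewrite -subr_eq0 -raddfB; apply: D0.
  by rewrite Quotient.idealrBE reprK.
have EB : zmod_morphism E.
  move=> x y; rewrite -[x]reprK -[y]reprK -[X in E X]raddfB.
  by rewrite !Epi raddfB.
have phiP : (fun x : IS => E (val x)) \in @is_hom IS A.
  by apply/asboolP => x y; rewrite raddfB EB.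
have phiE : restr (Hom_comp (to_im_grp incl_map) (Subgrp phiP)) = chi.
  apply/funext => s; have [[g h] /= sE] := pairP (val s).
  rewrite (chiE s g h sE) -DE /restr /= [LHS](congr1 E (quot_map_pi _ _)) Epi.
  by rewrite /= sE.
by exists (Subgrp phiP); split=> // psi psiE; apply: uniq_phi; rewrite phiE.
Qed.

End Coefficients.
End Cohomology.

(* Main.v *)
From HB Require Import structures.
Require Import Defs.
From mathcomp Require Import all_boot all_order all_algebra finmap.
From mathcomp Require Import ring_quotient zify.
From mathcomp Require Import boolp classical_sets functions cardinality.
From mathcomp.multinomials Require Import freeg.

Set Implicit Arguments.
Unset Strict Implicit.
Unset Printing Implicit Defensive.

Import Order.TTheory GRing.Theory Num.Theory.
Local Open Scope ring_scope.

(* The map {g, h} |-> [g] + [h] - [gh] embeds Z_G into the free abelian group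
   Z[G]: composing it with the homomorphism [g] |-> (0, g) from Z[G] to the
   extension of G by Z_G defined by the universal symmetric cocycle gives back
   the inclusion of Z_G. So I_S, a subgroup of Z[G], is torsion-free, and
   B^2_S(A) consists of the homomorphisms Z_S -> A that factor through
   Z_S -> Z[G].

   Split F^x as {1, -1} x F_{>0}. Since F is real closed, F_{>0} is uniquely
   divisible, hence injective: every homomorphism I_S -> F_{>0} extends to Z[G]
   and is a coboundary, and homomorphisms K_S -> F_{>0} extend to Z_S. As I_S is
   torsion-free, K_S/2 -> Z_S/2 is injective, so homomorphisms K_S -> {1, -1}
   extend to Z_S too. Thus 0 -> Hom(I_S, F^x)/B^2 -> H^2_S -> Hom(K_S, F^x) -> 0
   is exact, with Hom(I_S, F^x)/B^2 = Hom(I_S, {1, -1})/B^2; it splits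
   because the map Hom(I_S, F^x) -> Hom(I_S, {1, -1})/B^2, whose target is an
   elementary 2-group, kills the elements that are squares in Hom(Z_S, F^x), and
   so extends to Hom(Z_S, F^x).

   If G is finite, I_S is free of rank N', so Hom(I_S, {1, -1}) already has
   dimension N'. *)

(** * Homomorphism groups and maps out of quotients *)

Definition additive_of (A B : zmodType) (f : A -> B) (hf : zmod_morphism f) :
    {additive A -> B} :=
  HB.pack_for {additive A -> B} f (GRing.isZmodMorphism.Build A B f hf).

Definition zmodClosed_of (V : zmodType) (X : {pred V}) (hX : zmod_closed X) :
    zmodClosed V :=
  HB.pack_for (zmodClosed V) X (GRing.isZmodClosed.Build V X hX).

Definition Hom_of (A B : zmodType) (f : {additive A -> B}) : HomZ A B :=
  Subgrp (asboolT (raddfB f) : (f : A -> B) \in @is_hom A B).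

Definition hom_fun (A B : zmodType) (phi : HomZ A B) : {additive A -> B} :=
  additive_of (HomB phi).

Definition Hom_post (A B C : zmodType) (g : {additive B -> C}) (phi : HomZ A B) :
  HomZ A C := Hom_of (g \o hom_fun phi).

Lemma Hom_post_additive (A B C : zmodType) (g : {additive B -> C}) :
  zmod_morphism (@Hom_post A B C g).
Proof.
by move=> phi psi; apply: val_inj; apply/funext => x; rewrite /= raddfB.
Qed.
HB.instance Definition _ (A B C : zmodType) (g : {additive B -> C}) :=
  GRing.isZmodMorphism.Build (HomZ A B) (HomZ A C) (Hom_post g)
    (@Hom_post_additive A B C g).

Lemma factor_surj (A B C : zmodType) (p : {additive A -> B}) (g : {additive A -> C}) :
    (forall y, exists x, p x = y) -> (forall x, p x = 0 -> g x = 0) ->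
  exists h : {additive B -> C}, forall x, h (p x) = g x.
Proof.
move=> surj_p ker_le; pose s y := sval (cid (surj_p y)).
have ps y : p (s y) = y by rewrite /s; case: cid.
have gs x y : p x = y -> g (s y) = g x.
  move=> xy; apply/eqP; rewrite -subr_eq0 -raddfB ker_le //.
  by rewrite raddfB ps xy subrr.
have hB : zmod_morphism (g \o s).
  by move=> x y /=; rewrite -raddfB; apply: gs; rewrite raddfB !ps.
by exists (additive_of hB) => x; apply: gs.
Qed.

Lemma pi_eq0 (V : zmodType) (I : zmodClosed V) (x : V) :
  \pi_(Quotient.quot I)%qT x = 0 <-> x \in I.
Proof.
rewrite -{1}(raddf0 (\pi_(Quotient.quot I)%qT)) -[x in x \in _]subr0.
by split=> [/eqP|xI]; [|apply/eqP]; rewrite -?Quotient.idealrBE // Quotient.idealrBE.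
Qed.

Lemma surj_iso (A B : zmodType) (I : zmodClosed A) (h : {additive A -> B}) :
    (forall x, x \in I <-> h x = 0) -> (forall y, exists x, h x = y) ->
  isomorphic (Quotient.quot I) B.
Proof.
move=> ker_h surj_h.
have [x|x|k kE] := @factor_surj _ _ _ (\pi_(Quotient.quot I)%qT :
    {additive A -> Quotient.quot I}) h.
- by exists (repr x); exact: reprK.
- by move=> /pi_eq0/ker_h.
exists k; have inj_k : injective k.
  by apply: raddf_inj => y; rewrite -[y]reprK kE => /ker_h/pi_eq0.
pose s y := \pi_(Quotient.quot I)%qT (sval (cid (surj_h y))).
have ks : cancel s k by move=> y; rewrite /s kE; case: cid.
by exists s => // x; apply: inj_k; rewrite ks.
Qed.

(** * Extension of homomorphisms *)

(* A subgroup [W] of [C * A] meeting [0 * A] trivially is the graph of a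
   homomorphism defined on a subgroup of [C]; the last hypothesis says that such
   a homomorphism can always be extended to one more element. *)
Lemma extend_graph (C A : zmodType) (W0 : zmodClosed (C * A)%type) :
    (forall a, (0, a) \in W0 -> a = 0) ->
    (forall W : zmodClosed (C * A)%type, {subset W0 <= W} ->
       (forall a, (0, a) \in W -> a = 0) ->
       forall x, exists a, forall (n : int) b, (x *~ n, b) \in W -> b = a *~ n) ->
  exists h : {additive C -> A}, forall x a, (x, a) \in W0 -> h x = a.
Proof.
move=> W0fun step.
(* [W0] is adjoined to every [X], so that in Zorn's lemma the union of the empty chain is admissible
   too. *)
pose U (X : set (C * A)%type) : {pred (C * A)%type} := fun x => `[< X x >] || (x \in W0).
pose P X := zmod_closed (U X) /\ forall a, (0, a) \in U X -> a = 0.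
have memU X x : reflect (X x \/ x \in W0) (x \in U X).
  by apply: (iffP orP) => -[/asboolP Xx|W0x]; [left|right|left|right].
have [F FP totF|M [[clM funM] maxM]] := @Zorn_bigcup _ P.
  have subU X x : F X -> x \in U X -> x \in U (\bigcup_(X in F) X)%classic.
    by move=> FX /memU[Xx|W0x]; apply/memU; [left; exists X|right].
  split=> [|a].
    split=> [|x y]; first by apply/memU; right; rewrite rpred0.
    case/memU => [[X FX Xx]|W0x]; case/memU => [[Y FY Yy]|W0y].
    - case: (totF X Y FX FY) => [XY|YX].
        by apply: (subU Y) => //; apply: (FP Y FY).1.2; apply/memU; left=> //; apply: XY.
      by apply: (subU X) => //; apply: (FP X FX).1.2; apply/memU; left=> //; apply: YX.
    - by apply: (subU X) => //; apply: (FP X FX).1.2; apply/memU; [left|right].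
    - by apply: (subU Y) => //; apply: (FP Y FY).1.2; apply/memU; [right|left].
    - by apply/memU; right; rewrite rpredB.
  case/memU => [[X FX Xa]|/W0fun //].
  by apply: (FP X FX).2; apply/memU; left.
pose W := zmodClosed_of clM.
have W0W : {subset W0 <= W} by move=> x W0x; apply/memU; right.
have total x : exists a, (x, a) \in W.
  have [a aP] := step W W0W funM x; exists a.
  (* [V] is the sum of [W] and the cyclic group generated by [(x, a)]. The choice of [a] keeps it a
     graph, so maximality forces [(x, a)] into [W]. *)
  pose V : {pred (C * A)%type} := fun y => `[< exists n, y - (x *~ n, a *~ n) \in W >].
  have clV : zmod_closed V.
    split=> [|y z /asboolP[n yn] /asboolP[m zm]]; apply/asboolP.
      by exists 0; rewrite !mulr0z subr0 rpred0.
    exists (n - m); have -> : y - z - (x *~ (n - m), a *~ (n - m)) =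
        y - (x *~ n, a *~ n) - (z - (x *~ m, a *~ m)); last exact: rpredB.
    rewrite !mulrzBr -[(_ - _, _)]/((x *~ n, a *~ n) - (x *~ m, a *~ m)).
    by rewrite !opprB [LHS]addrACA [RHS]addrACA [- z - _]addrC.
  have WV : {subset W <= V} by move=> y Wy; apply/asboolP; exists 0; rewrite !mulr0z subr0.
  have funV b : (0, b) \in V -> b = 0.
    case/asboolP => n; rewrite -[_ - _]/(0 - _, _ - _) sub0r -mulrNz => /aP.
    by move/eqP; rewrite mulrNz -subr_eq0 opprK subrK => /eqP.
  have Vxa : (x, a) \in V by apply/asboolP; exists 1; rewrite subrr rpred0.
  have UV y : (y \in U [set y | y \in V]%classic) = (y \in V).
    by apply/memU/idP => [[|/W0W/WV]|] //; left.
  apply: contrapT => Wxa; apply: (maxM [set y | y \in V]%classic).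
    split=> [y My|VM]; first by apply: WV; apply/memU; left.
    by apply: Wxa; apply/memU; left; apply: VM.
  split=> [|b]; last by rewrite UV => /funV.
  split=> [|y z]; first by rewrite UV clV.1.
  by rewrite !UV; apply: clV.2.
have functional x a b : (x, a) \in W -> (x, b) \in W -> a = b.
  move=> Wa Wb; apply/eqP; rewrite -subr_eq0; apply/eqP/funM.
  by have := rpredB Wa Wb; rewrite -[_ - _]/(x - x, a - b) subrr.
pose s x := sval (cid (total x)).
have sW x : (x, s x) \in W by rewrite /s; case: cid.
have sB : zmod_morphism s.
  move=> x y; apply: functional (sW _) _.
  exact: (rpredB (sW x) (sW y)).
exists (additive_of sB) => x a /W0W; exact: functional.
Qed.

Lemma pair_mulz (A B : zmodType) (x : A) (y : B) (n : int) :
  (x, y) *~ n = (x *~ n, y *~ n).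
Proof.
by rewrite [LHS]surjective_pairing (raddfMz fst) (raddfMz snd).
Qed.

Definition uniquely_divisible (A : zmodType) : Prop :=
  forall (n : nat) (a : A), (0 < n)%N -> exists! b, b *+ n = a.

(** Start from the graph over the image of [i]. If a nonzero multiple of a new element already has a
    value, divide that value; otherwise send the element to 0. *)
Lemma extend_divisible (B C A : zmodType) (i : {additive B -> C})
    (phi : {additive B -> A}) :
    uniquely_divisible A -> (forall x, i x = 0 -> phi x = 0) ->
  exists h : {additive C -> A}, forall x, h (i x) = phi x.
Proof.
move=> divA ker_i.
have divz (n : int) (a : A) : n != 0 -> exists! b, b *~ n = a.
  case: n => [[|n]|n] // _; first exact: divA.
  have [b [bE bU]] := divA n.+1 (- a) isT.
  exists b; split=> [|c cE].
    by rewrite NegzE mulrNz -pmulrn bE opprK.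
  by apply: bU; rewrite -cE NegzE mulrNz opprK.
pose X : {pred (C * A)%type} := fun y => `[< exists x, y = (i x, phi x) >].
have clX : zmod_closed X.
  split=> [|_ _ /asboolP[x ->] /asboolP[y ->]]; apply/asboolP.
    by exists 0; rewrite !raddf0.
  by exists (x - y); rewrite !raddfB.
have [|W _ funW x|h hE] := @extend_graph C A (zmodClosed_of clX).
- by move=> a /asboolP[x [/esym/ker_i + ->]].
- have [[n [b [n0 Wb]]]|none] :=
    pselect (exists n b, n != 0 /\ (x *~ n, b) \in W); last first.
    exists 0 => n b Wb; case: (eqVneq n 0) => [n0|n0].
      by move: Wb; rewrite n0 !mulr0z => /funW.
    by case: none; exists n, b.
  have [a [aE aU]] := divz n b n0; exists a => m c Wc.
  (* Both [c *~ n] and [b *~ m] are values at [x *~ (m * n)], hence equal; so [c] and [a *~ m] have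
     the same [n]-fold multiple and coincide. *)
  have Wmn : (x *~ (m * n), c *~ n) \in W.
    by have := rpredMz n Wc; rewrite pair_mulz -mulrzA.
  have Wnm : (x *~ (m * n), b *~ m) \in W.
    by have := rpredMz m Wb; rewrite pair_mulz -mulrzA mulrC.
  have cb : c *~ n = b *~ m.
    have := rpredB Wmn Wnm; rewrite -[_ - _]/(_ - _, c *~ n - b *~ m) subrr.
    by move=> /funW/eqP; rewrite subr_eq0 => /eqP.
  have [d [_ dU]] := divz n (b *~ m) n0.
  by rewrite -(dU c) // -(dU (a *~ m)) // mulrzAC aE.
- by exists h => x; apply: hE; apply/asboolP; exists x.
Qed.

Lemma elementary_mulz (A : zmodType) (a : A) (n : int) :
  elementary_2 A -> a *~ n = a *+ odd `|n|%N.
Proof.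
move=> A2; have aN : - a = a by apply/eqP; rewrite eq_sym -subr_eq0 opprK A2.
have am (m : nat) : a *+ m = a *+ odd m.
  by rewrite -{1}(odd_double_half m) mulrnDr -muln2 mulnC mulrnA mulr2n A2 mul0rn addr0.
case: n => n; first by rewrite -pmulrn am.
by rewrite [LHS]/intmul -mulNrn aN; exact: am.
Qed.

(** Every homomorphism into [A] kills doubles, so the graph is first enlarged by all [(z + z, 0)];
    [ker_i] keeps it single-valued. After that only the parity of a multiple matters. *)
Lemma extend_elementary (B C A : zmodType) (i : {additive B -> C})
    (phi : {additive B -> A}) :
    elementary_2 A -> (forall x y, i x = y + y -> phi x = 0) ->
  exists h : {additive C -> A}, forall x, h (i x) = phi x.
Proof.
move=> A2 ker_i.
pose X : {pred (C * A)%type} := fun y => `[< exists x z, y = (i x + (z + z), phi x) >].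
have clX : zmod_closed X.
  split=> [|_ _ /asboolP[x [z ->]] /asboolP[y [w ->]]]; apply/asboolP.
    by exists 0, 0; rewrite !raddf0 !addr0.
  exists (x - y), (z - w).
  rewrite -[LHS]/(i x + (z + z) - (i y + (w + w)), phi x - phi y) !raddfB !opprD.
  by rewrite [z - w + _]addrACA [i x - i y + _]addrACA.
have [|W XW funW x|h hE] := @extend_graph C A (zmodClosed_of clX).
- move=> a /asboolP[x [z [/esym/eqP + ->]]]; rewrite addr_eq0 opprD => /eqP.
  exact: ker_i.
- have W2 y : (y + y, 0) \in W.
    by apply: XW; apply/asboolP; exists 0, y; rewrite !raddf0 add0r.
  have oddW (n : int) b : (x *~ n, b) \in W -> (x *+ odd `|n|%N, b) \in W.
    move=> Wb; have [k nE] : exists k : int, n = (odd `|n|)%:Z + (k + k).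
      have := odd_double_half `|n|; case: n {Wb} => n /= nE.
        by exists n./2; lia.
      (* The remainder must be [+1], not [-1], when [n.+1] is odd; hence the extra [odd n.+1] in the
         quotient. *)
      by exists (- (n.+1./2 + odd n.+1)%N%:Z); rewrite NegzE /=; lia.
    have := rpredB Wb (W2 (x *~ k)).
    rewrite -[_ - _]/(_ - _, b - 0) subr0 {1}nE !mulrzDr.
    by rewrite -[- _]/(- (x *~ k + x *~ k)) addrK -pmulrn.
  have fun2 y b c : (y, b) \in W -> (y, c) \in W -> b = c.
    move=> Wb Wc; apply/eqP; rewrite -subr_eq0; apply/eqP/funW.
    by have := rpredB Wb Wc; rewrite -[_ - _]/(y - y, b - c) subrr.
  (* If [x] has a value, it is forced. If not, only even multiples of [x] have one, and it is 0. *)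
  have [[a Wa]|none] := pselect (exists a, (x, a) \in W).
    exists a => n b /oddW; rewrite elementary_mulz //.
    by case: odd => [/fun2/(_ Wa)|/funW].
  exists 0 => n b /oddW; rewrite mul0rz.
  by case: odd => [Wb|/funW //]; case: none; exists b.
- by exists h => x; apply: hE; apply/asboolP; exists x, 0; rewrite !addr0.
Qed.

(** * Maps out of free groups and quotients; unordered pairs *)

Lemma freeg_lift (K : choiceType) (A : zmodType) (d : K -> A) :
  exists D : {additive {freeg K} -> A}, forall k, D << k >> = d k.
Proof.
pose d' : K -> ssrint.zmodule A := d.
pose D := additive_of (lift_is_additive d' : @zmod_morphism {freeg K} A (fglift d')).
by exists D => k; have := liftU d' 1 k; rewrite scale1r.
Qed.

Lemma freeg_hom_ext (K : choiceType) (A : zmodType) (D D' : {additive {freeg K} -> A}) :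
  (forall k, D << k >> = D' << k >>) -> forall x, D x = D' x.
Proof.
move=> DD' x; rewrite -[x]freeg_sumE !raddf_sum; apply: eq_bigr => k _.
have -> : << coeff k x *g k >> = << k >> *~ coeff k x by rewrite freegU_mulz intz.
by rewrite !raddfMz DD'.
Qed.

Lemma quot_lift (A B : zmodType) (I : zmodClosed A) (g : {additive A -> B}) :
    (forall x, x \in I -> g x = 0) ->
  exists h : {additive Quotient.quot I -> B},
    forall x, h (\pi_(Quotient.quot I)%qT x) = g x.
Proof.
move=> gI; apply: (@factor_surj _ _ _ (\pi_(Quotient.quot I)%qT :
    {additive A -> Quotient.quot I})) => [x|x /pi_eq0 /gI //].
by exists (repr x); exact: reprK.
Qed.

Lemma pair_ofP (G : zmodType) (p : pairs G) : exists g h, p = pair_of g h.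
Proof.
case: p => p p12; have := p12; rewrite {1}/is_pair.
case En: #|` p| => [|[|[|n]]] // _.
  have /cardfs1P[g pE] : #|` p| == 1%N by rewrite En.
  by exists g, g; apply: val_inj; rewrite /= pE fsetUid.
have /fset0Pn[g gp] : p != fset0%fset by rewrite -cardfs_gt0 En.
have /cardfs1P[h pE] : #|` p `\ g|%fset == 1%N.
  by move/eqP: En; rewrite (cardfsD1 g) gp add1n eqSS.
by exists g, h; apply: val_inj; rewrite /= -pE fsetD1K.
Qed.

(** * The embedding of Z_G into Z[G] *)

Section TwistedGroup.
Variable G : zmodType.

Definition cocycle (g h : G) : ZG G :=
  \pi_(Quotient.quot (generated (@RG G)))%qT (gen_of g h).

Lemma cocycleC g h : cocycle g h = cocycle h g.
Proof.
rewrite /cocycle /gen_of (_ : pair_of g h = pair_of h g) //.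
by apply: val_inj; rewrite /= fsetUC.
Qed.

Lemma cocycle_eq g h k :
  cocycle g h + cocycle (g + h) k = cocycle h k + cocycle g (h + k).
Proof.
apply/eqP; rewrite -subr_eq0 opprD addrA -!raddfD -!raddfB; apply/eqP/pi_eq0.
by apply: mem_generated; exists g, h, k.
Qed.

Lemma cocycle0 g : cocycle 0 g = cocycle 0 0.
Proof. by have := cocycle_eq 0 0 g; rewrite !add0r => /addIr. Qed.

(* The extension of [G] by [Z_G] classified by the universal symmetric cocycle. *)
Definition twisted : Type := (ZG G * G)%type.
HB.instance Definition _ := Choice.on twisted.

Definition tw_add (x y : twisted) : twisted :=
  (x.1 + y.1 + cocycle x.2 y.2, x.2 + y.2).
(** The universal cocycle is not normalised, which shifts the neutral element. *)
Definition tw_zero : twisted := (- cocycle 0 0, 0).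
Definition tw_opp (x : twisted) : twisted :=
  (- x.1 - cocycle x.2 (- x.2) - cocycle 0 0, - x.2).

Lemma tw_addA : associative tw_add.
Proof.
move=> [a g] [b h] [c k]; congr pair; rewrite /= ?addrA //.
rewrite -!addrA; congr (_ + (_ + _)).
by rewrite [RHS]addrCA cocycle_eq.
Qed.
Lemma tw_addC : commutative tw_add.
Proof. by move=> [a g] [b h]; congr pair; rewrite /= ?(cocycleC g) addrC // [b + a]addrC addrC. Qed.
Lemma tw_add0 : left_id tw_zero tw_add.
Proof. by move=> [a g]; congr pair; rewrite /= ?add0r // cocycle0 addrAC addNr add0r. Qed.
Lemma tw_addN : left_inverse tw_zero tw_opp tw_add.
Proof.
move=> [a g]; congr pair; rewrite /= ?addNr // [cocycle (- g) g]cocycleC.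
by rewrite addrAC [- a - _ - _]addrAC addrNK addrAC addNr add0r.
Qed.
HB.instance Definition _ := GRing.isZmodule.Build twisted tw_addA tw_addC tw_add0 tw_addN.

Lemma free_embedding : exists T : {additive ZG G -> {freeg G}},
  injective T /\
  forall g h, T (cocycle g h) = << g >> + << h >> - << g + h >>.
Proof.
have [d dE] : exists d : pairs G -> {freeg G},
    forall g h, d (pair_of g h) = << g >> + << h >> - << g + h >>.
  have H p : exists y : {freeg G}, forall g h, p = pair_of g h ->
      y = << g >> + << h >> - << g + h >>.
    have [g [h ->]] := pair_ofP p; exists (<< g >> + << h >> - << g + h >>).
    by move=> g' h' /pair_of_inj[[-> ->]|[-> ->]] //; rewrite addrC [<< _ >> + _]addrC [h' + _]addrC addrC.
  by exists (fun p => sval (cid (H p))) => g h; case: cid => y /= /(_ g h erefl).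
have [t tE] := freeg_lift d.
have [|T TE] := @quot_lift _ _ (generated (@RG G)) t.
  have D0 : {subset generated (@RG G) <= ker_grp t}.
    apply: generated_min => _ [g [h [k ->]]]; apply/eqP.
    rewrite !raddfB raddfD !tE !dE -[LHS]addrA -opprD; apply/eqP.
    rewrite subr_eq0 !addrA subrK; apply/eqP; congr (_ - _).
    by rewrite [RHS]addrAC subrK [RHS]addrC addrA.
  by move=> x /D0/eqP.
exists T; split; last by move=> g h; rewrite TE tE.
have [s sE] := freeg_lift (fun g => (0, g) : twisted).
(* Adding [(x, 0)] and [(y, 0)] picks up a [cocycle 0 0]; the shift absorbs it and makes the
   inclusion of Z_G additive. *)
pose j z : twisted := (z - cocycle 0 0, 0).
have jB : zmod_morphism j.
  move=> x y; congr pair; rewrite /= ?subr0 //.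
  by rewrite oppr0 opprB -[RHS]addrA subrK !addrA subrK.
(* On a generator both sides equal [(0, g) + (0, h) - (0, g + h)]. Since [j] is injective, so is
   [T]. *)
have jE x : s (T x) = additive_of jB x.
  pose p : {additive FG G -> ZG G} := \pi_(Quotient.quot (generated (@RG G)))%qT.
  rewrite -[x]reprK.
  apply: (freeg_hom_ext (D := s \o T \o p) (D' := additive_of jB \o p)) => q.
  have [g [h ->]] := pair_ofP q.
  rewrite /= -[p _]/(cocycle g h) [T _]TE tE dE raddfB raddfD !sE.
  apply/eqP; rewrite subr_eq; apply/eqP.
  by congr pair; rewrite /= ?add0r // cocycle0 addr0 subrK.
apply: raddf_inj => x Tx0; have := jE x; rewrite Tx0 raddf0 => /(congr1 fst) e.
apply: (addIr (- cocycle 0 0)); rewrite add0r.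
exact: esym e.
Qed.

End TwistedGroup.

(** * Coboundaries as homomorphisms factoring through Z[G] *)

Section Coboundaries.
Variables (G : zmodType) (S : set (pairs G)).
Variables (T : {additive ZG G -> {freeg G}}).
Hypothesis TE : forall g h, T (cocycle g h) = << g >> + << h >> - << g + h >>.

(** A map [G -> A] is the same as a homomorphism from Z[G], and its coboundary is that homomorphism
    composed with [T]; comparing on the generators in [S] suffices. *)
Lemma B2_ZSP (A : zmodType) (phi : HomZ (ZS S) A) :
  phi \in B2_ZS S A <->
  exists chi : {additive {freeg G} -> A}, forall z, val phi z = chi (T (incl_map S z)).
Proof.
split=> [/asboolP[a aE]|[chi chiE]]; last first.
  apply/asboolP; exists (fun g => chi << g >>) => s g h sE.
  rewrite [LHS](chiE (class_of s)) [incl_map S _]quot_map_pi /= sE.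
  by rewrite -[\pi_(_)%qT _]/(cocycle g h) TE raddfB raddfD.
have [chi chiE] := freeg_lift a; exists chi => z; rewrite -[z]reprK.
pose p : {additive FS S -> ZS S} := \pi_(Quotient.quot (generated (@RS G S)))%qT.
apply/eqP; rewrite -subr_eq0; apply/eqP.
apply: (@FS_hom_eq0 _ _ _ ((hom_fun phi \o p) \- (chi \o T \o incl_map S \o p))) => s.
have [g [h sE]] := pair_ofP (val s).
rewrite /= [val phi _](aE s g h sE) [incl_map S _]quot_map_pi /= sE.
by rewrite -[\pi_(_)%qT _]/(cocycle g h) TE (raddfB chi) (raddfD chi) !chiE subrr.
Qed.

End Coboundaries.

Lemma freeg_torsion_free (K : choiceType) (x : {freeg K}) (n : nat) :
  (0 < n)%N -> x *+ n = 0 -> x = 0.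
Proof.
move=> n0 xn; apply/eqP/freeg_eqP => k; rewrite coeff0.
have /eqP := congr1 (coeff k) xn.
by rewrite coeffMn coeff0 mulrn_eq0 eqn0Ngt n0 => /eqP.
Qed.

(** * Signs and positive elements of a real closed field *)

Section RealClosedUnits.
Variable F : rcfType.

Definition is_pos : {pred units F} := fun x => 0 < val x.
Lemma is_pos_closed : zmod_closed is_pos.
Proof.
split=> [|x y]; rewrite -!topredE /= /is_pos /= ?ltr01 // => x0 y0.
by rewrite mulr_gt0 ?invr_gt0.
Qed.
HB.instance Definition _ := GRing.isZmodClosed.Build (units F) is_pos is_pos_closed.

Definition positives : zmodType := subgrp is_pos.

Lemma units_valMn (x : units F) n : val (x *+ n) = val x ^+ n.
Proof. by elim: n => [|n IH]; rewrite ?mulr0n // mulrS exprS -IH. Qed.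

Lemma positives_divisible : uniquely_divisible positives.
Proof.
case=> // n a _; pose c := val (val a); have c0 : 0 < c := valP a.
(* A root of [X^(n.+1) - c] lies between 0 and [1 + c], because the power of [1 + c] is at least
   [1 + c]. *)
have [||x /andP[x0 _]] := @poly_ivt F ('X^(n.+1) - c%:P) 0 (1 + c).
- by rewrite addr_ge0 // ltW.
- rewrite !hornerE expr0n /= sub0r oppr_le0 subr_ge0 ltW //=.
  by rewrite (le_trans (y := 1 + c)) ?lerDr // ler_eXnr // lerDl ltW.
rewrite rootE !hornerE subr_eq0 => /eqP xn.
have {}x0 : 0 < x.
  by rewrite lt_def x0 andbT; apply: contraTneq c0 => x00; rewrite -xn x00 expr0n ltxx.
have xP : Units (lt0r_neq0 x0) \in is_pos by [].
exists (Subgrp xP); split=> [|y yE].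
  by apply: val_inj; apply: val_inj; rewrite raddfMn /= units_valMn.
apply: val_inj; apply: val_inj; apply: (pexpIrn (ltn0Sn n)).
- by rewrite nnegrE ltW.
- by rewrite nnegrE ltW //; exact: (valP y).
by rewrite /= xn /c -yE raddfMn /= units_valMn.
Qed.

Lemma sign_part_subproof (x : units F) :
  (Units (etrans (congr1 negb (sgr_eq0 (val x))) (units_neq0 x)) : units F) \in @is_sign F.
Proof.
rewrite -topredE /= /is_sign /=; have := units_neq0 x.
by case: sgrP; rewrite // eqxx ?orbT.
Qed.
Definition sign_part x : signs F := Subgrp (sign_part_subproof x).
Lemma sign_part_additive : zmod_morphism sign_part.
Proof. by move=> x y; do 2!apply: val_inj; rewrite /= sgrM sgrV invr_sg. Qed.
HB.instance Definition _ :=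
  GRing.isZmodMorphism.Build (units F) (signs F) sign_part sign_part_additive.

Lemma abs_part_subproof (x : units F) :
  (Units (etrans (congr1 negb (normr_eq0 (val x))) (units_neq0 x)) : units F) \in is_pos.
Proof. by rewrite -topredE /= /is_pos /= normr_gt0 units_neq0. Qed.
Definition abs_part x : positives := Subgrp (abs_part_subproof x).
Lemma abs_part_additive : zmod_morphism abs_part.
Proof. by move=> x y; do 2!apply: val_inj; rewrite /= normrM normfV. Qed.
HB.instance Definition _ :=
  GRing.isZmodMorphism.Build (units F) positives abs_part abs_part_additive.

Lemma sign_abs x : val (sign_part x) + val (abs_part x) = x.
Proof. by apply: val_inj; rewrite /= -numEsg. Qed.

Lemma sign_part_val (x : signs F) : sign_part (val x) = x.
Proof.
do 2!apply: val_inj; rewrite /=; have /orP[/eqP ->|/eqP ->] := valP x.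
  exact: sgr1.
by rewrite sgrN1.
Qed.

Lemma signs_elementary : elementary_2 (signs F).
Proof.
move=> x; do 2!apply: val_inj; rewrite /=.
by have /orP[/eqP ->|/eqP ->] := valP x; rewrite ?mulrNN mulr1.
Qed.

End RealClosedUnits.

(** * The splitting of H^2_S *)

Section Decomposition.
Variables (G : zmodType) (S : set (pairs G)) (F : rcfType).

Lemma HomIS_mod_B2_elementary : elementary_2 (HomIS_mod_B2 S (signs F)).
Proof.
move=> x; rewrite -[x]reprK -raddfD; apply/pi_eq0.
have -> : repr x + repr x = 0; last exact: rpred0.
by apply: val_inj; apply/funext => u; exact: signs_elementary.
Qed.

Lemma restriction_KS_surj (kappa : HomZ (KS S) (units F)) :
  exists phi : HomZ (ZS S) (units F), Hom_comp val phi = kappa.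
Proof.
have [T [injT _]] := free_embedding G.
have [|x y xyy|h hE] := @extend_elementary _ _ _ (val : {additive KS S -> ZS S})
    (@sign_part F \o hom_fun kappa).
- exact: signs_elementary.
(* If [x] in K_S is [y + y] in Z_S, then the image of [y] in Z[G] is 2-torsion, hence 0. So [y] lies
   in K_S and [x] is already a double there. *)
- have y0 : y \in ker_grp (incl_map S).
    apply/eqP/injT; rewrite raddf0; apply: (@freeg_torsion_free _ _ 2) => //.
    rewrite mulr2n -!raddfD -xyy; have /eqP := valP x.
    by move=> ->; rewrite raddf0.
  have -> : x = Subgrp y0 + Subgrp y0 by apply: val_inj.
  by rewrite raddfD signs_elementary.
have [|x x0|k kE] := @extend_divisible _ _ _ (val : {additive KS S -> ZS S})
    (@abs_part F \o hom_fun kappa).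
- exact: positives_divisible.
- by have -> : x = 0 by [apply: val_inj]; rewrite raddf0.
exists (Hom_of ((val \o h) \+ (val \o k))).
apply: val_inj; apply/funext => x /=.
by rewrite hE kE sign_abs.
Qed.

Lemma H2S_decomposition : isomorphic (H2S S (units F))
  (HomIS_mod_B2 S (signs F) * HomZ (KS S) (units F))%type.
Proof.
have [T [injT TE]] := free_embedding G.
pose E := HomIS_mod_B2 S (signs F).
pose infl : {additive HomZ (IS S) (units F) -> HomZ (ZS S) (units F)} :=
  Hom_comp (to_im_grp (incl_map S)).
pose res : {additive HomZ (ZS S) (units F) -> HomZ (KS S) (units F)} :=
  Hom_comp val.
pose class : {additive HomZ (IS S) (signs F) -> E} := \pi_(Quotient.quot (B2_IS S (signs F)))%qT.
have im_surj (u : IS S) : exists z, to_im_grp (incl_map S) z = u.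
  by have /asboolP[z zE] := valP u; exists z; apply: val_inj.
(* [Q] provides the splitting: it extends the class of the sign part along inflation. If the
   inflation of [psi] is a double, all values of [psi] are squares in the field, so its sign part is
   trivial. *)
have [|psi y psiE|Q QE] := @extend_elementary _ _ _ infl
    (class \o Hom_post (@sign_part F)).
- exact: HomIS_mod_B2_elementary.
- rewrite /= (_ : Hom_post _ _ = 0) ?raddf0 //.
  apply: val_inj; apply/funext => u; have [z <-] := im_surj u.
  rewrite /= [val psi _](congr1 (fun phi => val phi z) psiE) /=.
  by rewrite raddfD signs_elementary.
have infl_res psi : res (infl psi) = 0.
  apply: val_inj; apply/funext => x; rewrite /=.
  have -> : to_im_grp (incl_map S) (val x) = 0 by apply: val_inj; apply/eqP/(valP x).
  exact: (raddf0 (hom_fun psi)).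
have res0 phi z : res phi = 0 -> incl_map S z = 0 -> val phi z = 0.
  move=> r0 /eqP z0.
  exact: (congr1 (fun k => val k (Subgrp (z0 : z \in ker_grp (incl_map S)))) r0).
have resK phi : res phi = 0 -> exists psi, infl psi = phi.
  move=> r0; have [z z0|] := @factor_surj _ _ _ (to_im_grp (incl_map S)) (hom_fun phi) im_surj.
    by apply: res0 => //; exact: (congr1 val z0).
  move=> h hE; exists (Hom_of h); apply: val_inj; apply/funext => z; exact: hE.
have PhiB : zmod_morphism (fun phi => (Q phi, res phi) : (E * HomZ (KS S) (units F))%type).
  by move=> x y; rewrite !raddfB.
apply: (@surj_iso _ _ _ (additive_of PhiB)) => [phi|[e kappa]]; last first.
  (* Lift [kappa] first, then correct the [E]-component by an inflated sign homomorphism, which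
     [res] does not see. *)
  have [phi1 phi1E] := restriction_KS_surj kappa.
  pose psi := repr (e - Q phi1).
  pose phi2 := infl (Hom_post val psi).
  exists (phi1 + phi2); rewrite /= !raddfD infl_res [res _]phi1E addr0.
  congr (_, _); rewrite QE /= (_ : Hom_post _ _ = psi).
    by rewrite [class _]reprK addrC subrK.
  by apply: val_inj; apply/funext => u; exact: sign_part_val.
have inflB2 psi : infl psi = phi -> (Q phi = 0 <-> exists chi : {additive {freeg G} -> signs F},
    forall z, sign_part (val phi z) = chi (T (incl_map S z))).
  move=> <-; rewrite QE /=.
  apply: (iff_trans (pi_eq0 _ _)).
  exact: (B2_ZSP TE (Hom_comp (to_im_grp (incl_map S)) (Hom_post (@sign_part F) psi))).
split=> [/(B2_ZSP TE)[chi chiE]|Phi0].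
  have r0 : res phi = 0.
    apply: val_inj; apply/funext => x; rewrite /= chiE.
    by have /eqP -> := valP x; rewrite !raddf0.
  have [psi psiE] := resK _ r0.
  rewrite /= r0; congr (_, _); apply/(inflB2 psi psiE).
  by exists (@sign_part F \o chi) => z; rewrite chiE.
have [Q0 r0] : Q phi = 0 /\ res phi = 0.
  by split; [exact: (congr1 fst Phi0)|exact: (congr1 snd Phi0)].
have [psi psiE] := resK _ r0.
have [chi1 chi1E] := (inflB2 psi psiE).1 Q0.
(* The sign part of [phi] already factors through Z[G]. The absolute part does as well, by
   divisibility, since [phi] vanishes on the kernel of [T \o incl_map S]. *)
have [|z z0|chi2 chi2E] := @extend_divisible _ _ _ (T \o incl_map S) (@abs_part F \o hom_fun phi).
- exact: positives_divisible.
- by rewrite /= (res0 phi) ?raddf0 //; apply: injT; rewrite raddf0.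
apply/(B2_ZSP TE); exists ((val \o chi1) \+ (val \o chi2)) => z.
by rewrite /= -chi1E chi2E sign_abs.
Qed.

End Decomposition.

(** * Dimension over the field of 2 elements; free quotients by Smith normal form *)

Definition spanning (V : zmodType) (n : nat) (b : 'I_n -> V) : Prop :=
  forall x, exists c : 'I_n -> nat, x = \sum_i b i *+ c i.

(** A spanning family of minimal size is a basis: two different expansions of one element would make
    some member redundant. *)
Lemma elementary_dim (V : zmodType) (n : nat) (b : 'I_n -> V) :
    elementary_2 V -> spanning b ->
  exists2 d, has_dim_F2 V d & (d <= n)%N.
Proof.
move=> V2 b_span.
have mulE (v : V) (k : nat) : v *+ k = v *+ odd k.
  by have := elementary_mulz v k V2; rewrite -pmulrn.
have exd : exists d, `[< exists b : 'I_d -> V, spanning b >].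
  by exists n; apply/asboolP; exists b.
case: (ex_minnP exd) => d /asboolP[e e_span] dmin.
exists d; last by apply: dmin; apply/asboolP; exists b.
split=> //; exists e => x; have [c xE] := e_span x.
exists [ffun i => (c i)%:R : 'F_2]; split=> [|c' xE'].
  rewrite xE; apply: eq_bigr => i _.
  by rewrite ffunE mulE [RHS]mulE val_Fp_nat // modn2 oddb.
apply: contrapT => ne.
have [i ne_i] : exists i, odd (c i) != odd (c' i).
  apply: contrapT => odd_eq; apply: ne; apply/ffunP => i; apply: val_inj.
  rewrite ffunE [LHS](@val_Fp_nat 2) // modn2.
  have -> : odd (c i) = odd (c' i).
    by apply/eqP; apply: contrapT => /negP ?; apply: odd_eq; exists i.
  by case: (c' i) => [[|[|k]]].
case: d => [|d] in e e_span dmin c xE c' xE' ne i ne_i *; first by case: i {ne_i}.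
suff : (d.+1 <= d)%N by rewrite ltnn.
apply: dmin; apply/asboolP; exists (fun j => e (fintype.lift i j)).
(* The two expansions of [x] add up to 0, and there [e i] has an odd coefficient. *)
have ei : e i = \sum_j e (fintype.lift i j) *+ (c (fintype.lift i j) + c' (fintype.lift i j)).
  have := V2 x; rewrite {1}xE xE' -big_split /= (bigD1_ord i) //=.
  under eq_bigr do rewrite -mulrnDr.
  rewrite -mulrnDr [e i *+ _]mulE oddD -negb_eqb ne_i mulr1n => /eqP.
  rewrite addr_eq0 => /eqP ->.
  by apply/eqP; rewrite eq_sym -subr_eq0 opprK V2.
move=> y; have [a ->] := e_span y; rewrite (bigD1_ord i) //= {1}ei.
exists (fun j => (c (fintype.lift i j) + c' (fintype.lift i j)) * a i + a (fintype.lift i j))%N.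
rewrite -sumrMnl -big_split; apply: eq_bigr => j _ /=.
by rewrite [RHS]mulrnDr [in RHS]mulrnA.
Qed.

Lemma seq_spanning (V : zmodType) (s : seq V) :
  (forall x, x \in s) -> spanning (tnth (in_tuple s)).
Proof.
move=> sV x; have /tnthP[i ->] : x \in in_tuple s by apply: sV.
exists (fun j => j == i); rewrite (bigD1 i) //= eqxx big1 ?addr0 // => j /negPf ->.
by [].
Qed.

Lemma int_row_additive (A : zmodType) (m : nat) (u : {additive 'rV[int]_m -> A})
    (y : 'rV[int]_m) :
  u y = \sum_i u (delta_mx 0 i) *~ y 0 i.
Proof.
rewrite {1}[y]row_sum_delta raddf_sum; apply: eq_bigr => i _.
by rewrite -raddfMz -scaler_int intz.
Qed.

(** The image of [u] is a finitely generated subgroup of a lattice. Smith normal form of the matrix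
    of [u \o e] exhibits it as free. *)
Lemma int_image_free (A : zmodType) (m n : nat) (e : {additive 'rV[int]_m -> A})
    (u : {additive A -> 'rV[int]_n}) :
    (forall x, exists y, e y = x) ->
  exists r (h : {additive A -> 'rV[int]_r}),
    (forall v, exists x, h x = v) /\ (forall x, h x = 0 <-> u x = 0).
Proof.
move=> surj_e; pose M := \matrix_i u (e (delta_mx 0 i)).
have uM y : u (e y) = y *m M.
  rewrite [LHS](int_row_additive (u \o e)) mulmx_sum_row; apply: eq_bigr => i _.
  by rewrite rowK -scaler_int intz.
have [L uL [R uR [d _ ME]]] := int_Smith_normal_form M.
pose D : 'M[int]_(m, n) := \matrix_(i, j) (d`_i *+ (i == j :> nat)).
(* After the base change [L], the kernel is the vanishing of the coordinates in [J], those with a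
   nonzero diagonal entry. These coordinates define [h]. *)
pose J := [set i | [exists j, D i j != 0]].
have kerD (y : 'rV_m) : (y *m D == 0) = [forall i in J, y 0 i == 0].
  apply/eqP/forall_inP => [yD i|y0].
    rewrite inE => /existsP[j]; rewrite mxE; have [ij|_] := eqVneq (i : nat) j; last by rewrite eqxx.
    rewrite mulr1n => dj0; have := congr1 (fun A : 'rV_n => A 0 j) yD; rewrite !mxE (bigD1 i) //= mxE ij eqxx mulr1n.
    rewrite big1 ?addr0 => [/eqP|k /negPf ki]; first by rewrite mulf_eq0 -ij (negPf dj0) orbF.
    by rewrite mxE -ij (inj_eq val_inj) ki mulr0.
  apply/rowP => j; rewrite !mxE big1 // => i _.
  have [/y0/eqP ->|] := boolP (i \in J); first by rewrite mul0r.
  by rewrite inE negb_exists => /forallP/(_ j); rewrite negbK => /eqP ->; rewrite mulr0.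
pose g (y : 'rV[int]_m) : 'rV[int]_#|J| := \row_k (y *m L) 0 (enum_val k).
have gB : zmod_morphism g by move=> y z; rewrite /g mulmxBl; apply/rowP => k; rewrite !(mxE, mulmxBl).
have g0 y : g y = 0 <-> u (e y) = 0.
  rewrite uM ME !mulmxA -/D; split=> [gy|/eqP].
    suff /eqP -> : y *m L *m D == 0 by rewrite mul0mx.
    rewrite kerD; apply/forall_inP => i iJ.
    by have := congr1 (fun v : 'rV_#|J| => v 0 (enum_rank_in iJ i)) gy; rewrite !mxE enum_rankK_in // => ->.
  rewrite -[0](mul0mx _ R) (can_eq (mulmxK uR)) kerD => /forall_inP y0.
  by apply/rowP => k; rewrite [LHS]mxE [RHS]mxE; apply/eqP/y0/enum_valP.
have [//|y ey0|h hE] := @factor_surj _ _ _ e (additive_of gB).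
  by apply/g0; rewrite ey0 raddf0.
exists #|J|, h; split=> [v|x]; last first.
  by have [y <-] := surj_e x; rewrite hE; exact: g0.
(* Place the entries of [v] at the positions in [J], put zeros elsewhere, and undo [L]. *)
pose w : 'rV[int]_m := \row_i \sum_(k | enum_val k == i) v 0 k.
exists (e (w *m invmx L)); rewrite hE /= /g mulmxKV //; apply/rowP => k; rewrite !mxE.
by rewrite (big_pred1 k) // => l; rewrite /= (inj_eq enum_val_inj).
Qed.

(** * The rank bound for finite [G] *)

Section FiniteGroup.
Variables (G : zmodType) (S : set (pairs G)) (F : rcfType).
Hypothesis finG : finite_set [set: G].

Lemma finite_enum : exists s : seq G, forall g, g \in s.
Proof.
have /finite_seqP[s sE] := finG; exists s => g.
by have : [set` s]%classic g by rewrite -sE.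
Qed.

Lemma torsion_dim : exists r, has_dim_F2 (subgrp (@is_2torsion G)) r.
Proof.
have [s sG] := finite_enum; pose t : seq (subgrp (@is_2torsion G)) := pmap insub s.
have [x||r] := @elementary_dim _ _ (tnth (in_tuple t)).
- by apply: val_inj; exact/eqP/(valP x).
- by apply: seq_spanning => x; rewrite mem_pmap_sub.
- by exists r.
Qed.

(** The pairs in [S] give a surjection [e] from a lattice onto F_S, not injective when the list
    repeats pairs. The coefficients of the image in Z[G] give [u], whose kernel is the required one
    because [T] is injective. *)
Lemma FS_free_quotient : exists r (h : {additive FS S -> 'rV[int]_r}),
  (forall v, exists x, h x = v) /\
  (forall x, h x = 0 <-> (val x : FG G) \in generated (@RG G)).
Proof.
have [s sG] := finite_enum; have [T [injT _]] := free_embedding G.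
pose q : seq (set_type S) := pmap insub [seq pair_of g h | g <- s, h <- s].
have qS p : p \in q.
  rewrite mem_pmap_sub; have [g [h ->]] := pair_ofP (val p).
  by apply/allpairsP; exists (g, h).
pose e (y : 'rV[int]_(size q)) : FS S :=
  \sum_i (Subgrp (supported_gen (tnth (in_tuple q) i)) : FS S) *~ y 0 i.
have eB : zmod_morphism e.
  by move=> y z; rewrite /e -sumrB; apply: eq_bigr => i _; rewrite !mxE mulrzBr.
pose u (x : FS S) : 'rV[int]_(size s) :=
  \row_j coeff (tnth (in_tuple s) j) (T (\pi_(Quotient.quot (generated (@RG G)))%qT (val x))).
have uB : zmod_morphism u by move=> x y; apply/rowP => j; rewrite !mxE !raddfB.
have u0 x : u x = 0 <-> (val x : FG G) \in generated (@RG G).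
  split=> [ux|/pi_eq0 x0]; last by apply/rowP => j; rewrite !mxE x0 !raddf0.
  apply/pi_eq0/injT; rewrite raddf0; apply/eqP/freeg_eqP => g; rewrite coeff0.
  have /tnthP[j ->] : g \in in_tuple s by apply: sG.
  by have := congr1 (fun v : 'rV_(size s) => v 0 j) ux; rewrite !mxE.
have [x|r [h [h_surj h0]]] := int_image_free (e := additive_of eB) (additive_of uB).
  (* Surjectivity of [e]: the projection of F_S modulo its image kills every generator, so it is
     zero. *)
  have : x \in im_grp (additive_of eB); last by move/asboolP.
  apply/pi_eq0; pose J := im_grp (additive_of eB).
  apply: (@FS_hom_eq0 _ _ _ (\pi_(Quotient.quot J)%qT : {additive FS S -> Quotient.quot J})) => p.
  apply/pi_eq0/asboolP; have /tnthP[i ->] : p \in in_tuple q by apply: qS.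
  exists (delta_mx 0 i); rewrite /= /e (bigD1 i) //= mxE !eqxx mulr1z big1 ?addr0 // => k /negPf ki.
  by rewrite mxE ki andbF mulr0z.
by exists r, h; split=> // x; apply: (iff_trans (h0 x)).
Qed.

Lemma rank_bound : exists r N' d : nat,
  [/\ has_dim_F2 (subgrp (@is_2torsion G)) r,
      has_free_rank (FS_mod_RG S) N',
      has_dim_F2 (HomIS_mod_B2 S (signs F)) d &
      (d <= r + N')%N].
Proof.
have [r r_dim] := torsion_dim; have [n [h [h_surj h0]]] := FS_free_quotient.
have rV0 (v w : 'rV[int]_0) : v = w by apply/rowP => -[].
pose p : {additive FS S -> IS S} := to_im_grp (incl_map S) \o
  (\pi_(Quotient.quot (generated (@RS G S)))%qT : {additive FS S -> ZS S}).
have p_surj v : exists x, p x = v.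
  have /asboolP[z zE] := valP v; exists (repr z); apply: val_inj.
  by rewrite /= reprK.
have p0 x : p x = 0 <-> h x = 0.
  rewrite h0 -pi_eq0 -(quot_map_pi (@RS_sub_RG G S)).
  by split=> [/(congr1 val)|?] //; apply: val_inj.
(* [s] is the sign -1. *)
have [s sE] : exists s : signs F, forall a : signs F, a = 0 \/ a = s.
  have m1 : -1 != 0 :> F by rewrite oppr_eq0 oner_eq0.
  have m1P : (Units m1 : units F) \in @is_sign F by rewrite -topredE /= /is_sign eqxx orbT.
  exists (Subgrp m1P) => a; have /orP[/eqP a1|/eqP a1] := valP a; [left|right];
    by do 2!apply: val_inj.
(* Since [p] and [h] have the same kernel, I_S is a lattice with coordinates [h]; [delta k] is the
   [k]-th coordinate modulo 2. *)
have exdelta k : exists delta : {additive IS S -> signs F}, forall x, delta (p x) = s *~ h x 0 k.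
  have gB : zmod_morphism (fun x => s *~ h x 0 k).
    by move=> x y; rewrite raddfB !mxE mulrzBr.
  apply: (@factor_surj _ _ _ p (additive_of gB)) => // x /p0 hx.
  by rewrite /= hx mxE mulr0z.
pose delta k := sval (cid (exdelta k)).
have deltaE k x : delta k (p x) = s *~ h x 0 k by rewrite /delta; case: cid.
pose b k : HomIS_mod_B2 S (signs F) :=
  \pi_(Quotient.quot (B2_IS S (signs F)))%qT (Hom_of (delta k)).
have [||d d_dim dn] := @elementary_dim _ _ b.
- exact: HomIS_mod_B2_elementary.
- move=> x; have [om omE] := @factor_surj _ _ _ h (hom_fun (repr x) \o p) h_surj
    (fun y hy => etrans (congr1 (hom_fun (repr x)) ((p0 y).2 hy)) (raddf0 _)).
  (* A sign homomorphism on the lattice is determined by its values on the standard basis; the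
     coefficient records whether that value is -1. *)
  exists (fun k => om (delta_mx 0 k) != 0).
  have -> : x = \pi_(Quotient.quot (B2_IS S (signs F)))%qT
      (\sum_k Hom_of (delta k) *+ (om (delta_mx 0 k) != 0)).
    rewrite -[LHS]reprK; congr (\pi_(Quotient.quot (B2_IS S (signs F)))%qT _).
    apply: val_inj; apply/funext => v; have [y <-] := p_surj v.
    have evB : zmod_morphism (fun phi : HomZ (IS S) (signs F) => val phi (p y)) by [].
    rewrite -[LHS]omE int_row_additive [RHS](raddf_sum (additive_of evB)).
    apply: eq_bigr => k _; rewrite raddfMn /= deltaE.
    have [->|->] := sE (om (delta_mx 0 k)); first by rewrite eqxx mul0rz.
    by case: eqVneq => [->|_]; rewrite ?mul0rz.
  by rewrite raddf_sum; apply: eq_bigr => k _; rewrite raddfMn.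
exists r, n, d; split=> //; last by rewrite (leq_trans dn) // leq_addl.
(* The quotient is torsion-free, so the torsion summand is the zero group. *)
exists 'rV[int]_0; split=> [t|]; first by exists 1%N.
have kB : zmod_morphism (fun x => (h x, 0) : ('rV[int]_n * 'rV[int]_0)%type).
  by move=> x y; congr pair; rewrite ?raddfB.
apply: (surj_iso (h := additive_of kB)) => [x|[v w]].
  by split=> [/h0 hx|/(congr1 fst)/h0 //]; rewrite /= hx.
have [x <-] := h_surj v; exists x; congr pair; exact: rV0.
Qed.

End FiniteGroup.

Theorem corollary22 (G : zmodType) (S : set (pairs G)) (F : rcfType) :
  [/\ isomorphic (H2S S (units F))
        (HomIS_mod_B2 S (signs F) * HomZ (KS S) (units F))%type,
      elementary_2 (HomIS_mod_B2 S (signs F)) &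
      finite_set [set: G] ->
      exists r N' d : nat,
        [/\ has_dim_F2 (subgrp (@is_2torsion G)) r,
            has_free_rank (FS_mod_RG S) N',
            has_dim_F2 (HomIS_mod_B2 S (signs F)) d &
            (d <= r + N')%N]].
Proof.
split; first exact: H2S_decomposition.
  exact: HomIS_mod_B2_elementary.
exact: rank_bound.
Qed.
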